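(* There exists a function $f\colon \mathbb{R}_{>0} \to \mathbb{N}$ such that for every $\epsilon>0$ and every positive integer $k$, if $T$ is an $n$-vertex tournament with $n \geq 2k+1+\epsilon k$, then $\mathrm{sinv}_k(T) \leq f(\epsilon)$.
   Context: A tournament is an orientation of a complete graph. For a digraph $D$ and $X \subseteq V(D)$, inverting $X$ means reversing the direction of every arc of $D$ with both endvertices in $X$. A digraph $D$ is $k$-strong if $|V(D)|\ge k+1$ and $D-S$ is strongly connected for every $S\subseteq V(D)$ with $|S|<k$. $\mathrm{sinv}_k(D)$ is the minimum number of sets whose successive inversion transforms $D$ into a $k$-strong digraph. *)

(* Defs.v *)
From Stdlib Require Import Reals ClassicalEpsilon.
From mathcomp Require Import all_boot.
Set Implicit Arguments. Unset Strict Implicit. Unset Printing Implicit Defensive.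

(* A digraph on the vertex set 'I_n is given by its arc relation D : rel 'I_n
   (D x y means there is an arc x -> y). Digraphs are loopless. *)
Definition digraph (n : nat) := rel 'I_n.

Definition is_tournament n (D : digraph n) : Prop :=
  (forall x, ~~ D x x) /\ (forall x y, x != y -> D x y != D y x).

Definition invert n (D : digraph n) (X : {set 'I_n}) : digraph n :=
  fun x y => if (x \in X) && (y \in X) then D y x else D x y.

Definition invert_seq n (D : digraph n) (s : seq {set 'I_n}) : digraph n :=
  foldl (@invert n) D s.

Definition strong_minus n (D : digraph n) (S : {set 'I_n}) : bool :=
  [forall x, forall y, (x \notin S) ==> (y \notin S) ==>
     connect [rel u v | [&& u \notin S, v \notin S & D u v]] x y].

Definition kstrong n (k : nat) (D : digraph n) : bool :=
  (k.+1 <= n) && [forall S : {set 'I_n}, (#|S| < k) ==> strong_minus D S].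

Definition sinv_ok n (k : nat) (D : digraph n) (p : nat) : bool :=
  [exists s : p.-tuple {set 'I_n}, kstrong k (invert_seq D s)].

(* sinv_k(D): minimum number of inversions making D k-strong;
   None if no finite sequence of inversions works (value +infinity). *)
Definition sinv n (k : nat) (D : digraph n) : option nat :=
  match excluded_middle_informative (exists p, sinv_ok k D p) with
  | left h => Some (ex_minn h)
  | right _ => None
  end.

(* Main.v *)
(** Assign to each vertex [x] a class [c x] among [q] classes and random bits
    [s(x,j)], one per class, and flip the arc [xy] iff [s(x,c y) + s(y,c x) = 1]
    in F_2: this costs [3q] inversions.  For a fixed [x] the out-degree becomes a
    sum of independent fair bits, so a Chernoff bound makes all in- and out-degrees
    at least [k + h] with [h] linear in [n].  For fixed disjoint [A], [B] of size at
    least [h], the absence of arcs from [A] to [B] determines, for every [b] in [B],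
    the bits [s(b,i)] of all classes [i] met by [A], and there are many such classes
    when [q] is large; a union bound over all [A], [B] then gives an arc from [A] to
    [B] always.  Deleting fewer than [k] vertices leaves at least [h] out-neighbours
    of [x] and [h] in-neighbours of [y], so some path [x -> a -> b -> y] survives.
    When [n] is bounded, the same twisting with singleton classes turns the
    tournament into one containing the [k]-th power of a Hamiltonian cycle. *)

Require Import Defs.
From Stdlib Require Import Reals ClassicalEpsilon Lra.
From mathcomp Require Import all_boot.
From mathcomp Require Import zify.
Set Implicit Arguments. Unset Strict Implicit. Unset Printing Implicit Defensive.

(** * Twists realised by inversion sequences *)

Lemma leq_exp2r_homo m n e : m <= n -> m ^ e <= n ^ e.
Proof. by case: e => // e; rewrite leq_exp2r. Qed.

Lemma invert_seqE n (D : digraph n) (l : seq {set 'I_n}) x y :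
  invert_seq D l x y =
    if odd (count (fun X : {set 'I_n} => (x \in X) && (y \in X)) l)
    then D y x else D x y.
Proof.
elim: l D => [//|X l IH] D; rewrite /invert_seq /= -/(invert_seq _ l) IH /invert.
rewrite oddD [(y \in X) && _]andbC.
by case: ((x \in X) && _) => /=; case: odd.
Qed.

(** The random bits are encoded as a set [s], the bit of [(x, j)] being its membership, so that
    probabilities become counts of sets [s]. *)
Definition twist n q (T : digraph n) (c : 'I_n -> 'I_q)
    (s : {set 'I_n * 'I_q}) : digraph n :=
  fun x y => T x y (+) ((x, c y) \in s) (+) ((y, c x) \in s).

Definition twist_sets n q (c : 'I_n -> 'I_q) (s : {set 'I_n * 'I_q}) :
    seq {set 'I_n} :=
  flatten [seq [:: [set x | ((x, j) \in s) (+) (c x == j)];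
                   [set x | (x, j) \in s];
                   [set x | c x == j]] | j <- enum 'I_q].

Lemma size_twist_sets n q (c : 'I_n -> 'I_q) s : size (twist_sets c s) = 3 * q.
Proof.
rewrite size_flatten /shape -map_comp sumnE big_map big_enum /=.
by rewrite sum_nat_const card_ord mulnC.
Qed.

(* Each block of three sets flips exactly the pairs with one end in [U] and the
   other in [V], because over F_2
   U(x)V(y) + V(x)U(y) = (U+V)(x)(U+V)(y) + U(x)U(y) + V(x)V(y). *)
Lemma odd_count_twist_sets n q (c : 'I_n -> 'I_q) s x y :
  odd (count (fun X : {set 'I_n} => (x \in X) && (y \in X)) (twist_sets c s))
  = ((x, c y) \in s) (+) ((y, c x) \in s).
Proof.
have E r : uniq r -> odd (count (fun X : {set 'I_n} => (x \in X) && (y \in X))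
    (flatten [seq [:: [set x | ((x, j) \in s) (+) (c x == j)];
                   [set x | (x, j) \in s];
                   [set x | c x == j]] | j <- r]))
   = ((c y \in r) && ((x, c y) \in s)) (+) ((c x \in r) && ((y, c x) \in s)).
  elim: r => [//|j r IH] /= /andP[jr /IH {}IH].
  rewrite !addnA -(addn0 (_ + _ + _)) !oddD IH !inE.
  have [Ey|_] := eqVneq (c y) j; have [Ex|_] := eqVneq (c x) j;
    rewrite ?Ey ?Ex ?(negPf jr) /=;
    by case: ((x, j) \in s); case: ((y, j) \in s); case: (c y \in r);
       case: (c x \in r); case: ((x, c y) \in s); case: ((y, c x) \in s).
by rewrite E ?enum_uniq // !mem_enum.
Qed.

Lemma invert_seq_twist n q (T : digraph n) (c : 'I_n -> 'I_q) s :
  is_tournament T -> invert_seq T (twist_sets c s) =2 twist T c s.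
Proof.
move=> [T0 T1] x y; rewrite invert_seqE odd_count_twist_sets /twist -addbA.
have [->|/T1] := eqVneq x y; first by rewrite (negPf (T0 y)) addbb.
by case: (T x y); case: (T y x); case: (_ (+) _).
Qed.

Lemma eq_strong_minus n (D D' : digraph n) S :
  D =2 D' -> strong_minus D S = strong_minus D' S.
Proof.
move=> DD; apply: eq_forallb => x; apply: eq_forallb => y.
by congr (_ ==> (_ ==> _)); apply: eq_connect => u v /=; rewrite DD.
Qed.

Lemma eq_kstrong n k (D D' : digraph n) :
  D =2 D' -> kstrong k D = kstrong k D'.
Proof.
move=> DD; congr (_ && _); apply: eq_forallb => S.
by rewrite (eq_strong_minus S DD).
Qed.

Lemma sinv_le n k (T : digraph n) (l : seq {set 'I_n}) :
  kstrong k (invert_seq T l) -> exists m, sinv k T = Some m /\ m <= size l.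
Proof.
move=> ks; have ok : sinv_ok k T (size l).
  by apply/existsP; exists (in_tuple l).
rewrite /sinv; case: excluded_middle_informative => [h|[]]; last by exists (size l).
exists (ex_minn h); split=> //.
by case: ex_minnP => m _; apply.
Qed.

(** * Strong connectivity from degrees and expansion *)

Lemma kstrong_expanding n k h (D : digraph n) :
  k < n ->
  (forall x, k + h <= #|[set y | D x y]|) ->
  (forall x, k + h <= #|[set y | D y x]|) ->
  (forall A B : {set 'I_n}, [disjoint A & B] -> h <= #|A| -> h <= #|B| ->
     exists a b, [/\ a \in A, b \in B & D a b]) ->
  kstrong k D.
Proof.
move=> kn dout din exp; rewrite /kstrong kn; apply/forallP=> S; apply/implyP=> Sk.
apply/forallP=> x; apply/forallP=> y; apply/implyP=> xS; apply/implyP=> yS.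
set e := (X in connect X).
have szD (X : {set 'I_n}) : k + h <= #|X| -> h <= #|X :\: S|.
  move=> le; have := subset_leq_card (subsetIr X S); have := cardsID S X; lia.
set A := [set z | D x z] :\: S; set B := [set z | D z y] :\: S.
have xA z : z \in A -> connect e x z.
  by rewrite !inE => /andP[zS xz]; apply: connect1; rewrite /e /= xS zS.
have By z : z \in B -> connect e z y.
  by rewrite !inE => /andP[zS xz]; apply: connect1; rewrite /e /= yS zS.
have [dAB|] := boolP [disjoint A & B].
  have [a [b [aA bB ab]]] := exp A B dAB (szD _ (dout x)) (szD _ (din y)).
  apply: connect_trans (xA a aA) (connect_trans _ (By b bB)).
  apply: connect1; rewrite /e /= ab andbT.
  by move: aA bB; rewrite !inE => /andP[-> _] /andP[-> _].
rewrite disjoint_subset => /subsetPn[z zA]; rewrite inE negbK => zB.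
exact: connect_trans (xA z zA) (By z zB).
Qed.

(** * Counting bad bit assignments *)

Lemma card_determined (X : finType) (K : {set X}) (P : {set {set X}}) :
  {in P &, injective (fun s => s :\: K)} -> #|P| * 2 ^ #|K| <= 2 ^ #|X|.
Proof.
move=> inj; rewrite -(card_in_imset inj) -(cardsC K) addnC expnD leq_mul2r.
rewrite -[X in _ || (_ <= X)]card_powerset subset_leq_card ?orbT //.
apply/subsetP=> _ /imsetP[s _ ->]; rewrite powersetE.
by apply/subsetP=> z; rewrite !inE => /andP[].
Qed.

(** The union bound with denominators cleared. *)
Lemma card_bigcup_mul (I X : finType) (P : pred I) (F : I -> {set X}) c d :
  (forall i, P i -> #|F i| * c <= d) -> #|\bigcup_(i | P i) F i| * c <= #|I| * d.
Proof.
move=> Fb; apply: (@leq_trans (\sum_(i | P i) d)); last first.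
  by rewrite sum_nat_const leq_mul2r max_card orbT.
elim/big_rec2: _ => [|i b S Pi IH]; first by rewrite cards0.
have := Fb i Pi; have := (leq_card_setU (F i) S).1; nia.
Qed.

Lemma card_class n q (c : 'I_n -> 'I_q) (j : 'I_q) :
  (forall y, c y = y %% q :> nat) -> #|[set y | c y == j]| <= (n %/ q).+1.
Proof.
move=> cE; set X := [set y | _].
pose f (y : 'I_n) : 'I_(n %/ q).+1 := inord (y %/ q).
have fE y : f y = y %/ q :> nat.
  by rewrite inordK // ltnS leq_div2r // ltnW.
have inj : {in X &, injective f}.
  move=> y z; rewrite !inE => /eqP yj /eqP zj /(congr1 val) /=; rewrite !fE => yz.
  by apply/val_inj; rewrite /= (divn_eq y q) (divn_eq z q) yz -!cE yj zj.
by rewrite -(card_in_imset inj) (leq_trans (max_card _)) ?card_ord.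
Qed.

(** A missing arc [ab] determines the bit [(b, c a)] from [T a b] and the bit [(a, c b)]. The latter
    lies outside [setX B (c @: A)] because [A] and [B] are disjoint, so the bits outside this
    product determine those inside. *)
Lemma card_no_arc n q (T : digraph n) (c : 'I_n -> 'I_q) (A B : {set 'I_n}) :
  [disjoint A & B] ->
  #|[set s | [forall a in A, forall b in B, ~~ twist T c s a b]]|
    * 2 ^ (#|B| * #|c @: A|) <= 2 ^ (n * q).
Proof.
move=> dAB.
have -> : n * q = #|{: 'I_n * 'I_q}| by rewrite card_prod !card_ord.
rewrite -cardsX; apply: card_determined => s t.
rewrite !inE => /forall_inP sP /forall_inP tP st.
have stE z : z \notin setX B (c @: A) -> (z \in s) = (z \in t).
  by move=> zK; move/setP/(_ z): st; rewrite !inE in zK *; rewrite zK.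
apply/setP=> -[b i]; have [|/stE//] := boolP ((b, i) \in setX B (c @: A)).
rewrite in_setX => /= /andP[bB /imsetP[a aA ->]].
have /forall_inP/(_ b bB) := sP a aA; have /forall_inP/(_ b bB) := tP a aA.
rewrite /twist (stE (a, c b)); last first.
  by rewrite in_setX /= (disjointFr dAB aA).
by case: (T a b); case: ((a, c b) \in t); case: ((b, c a) \in s); case: ((b, c a) \in t).
Qed.

(** Once the bits outside [K] are fixed, the [n.-1] bits [(y, c x)] with [y != x] can be read off
    from the neighbourhood of [x]. The predicate [g] lets one count serve both out- and
    in-neighbours. *)
Lemma card_low_degree n q (g : pred 'I_n) (c : 'I_n -> 'I_q) (x : 'I_n) m :
  #|[set s : {set 'I_n * 'I_q} |
      #|[set y | (y != x) && (g y (+) ((x, c y) \in s) (+) ((y, c x) \in s))]| <= m]|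
    * 2 ^ n.-1 <= 2 ^ (n * q) * #|[set W : {set 'I_n} | #|W| <= m]|.
Proof.
set P := [set s | _]; set Ws := [set W | _].
pose N (s : {set 'I_n * 'I_q}) :=
  [set y | (y != x) && (g y (+) ((x, c y) \in s) (+) ((y, c x) \in s))].
pose K := setX [set~ x] [set c x].
have cK : #|K| = n.-1 by rewrite cardsX cards1 muln1 cardsC1 card_ord.
have inj : {in P &, injective (fun s => (s :\: K, N s))}.
  move=> s t _ _ [st /setP NN].
  have stE z : z \notin K -> (z \in s) = (z \in t).
    by move=> zK; move/setP/(_ z): st; rewrite !inE in zK *; rewrite zK.
  apply/setP=> -[y i]; have [|/stE//] := boolP ((y, i) \in K).
  rewrite in_setX !inE => /= /andP[yx /eqP ->].
  move: (NN y); rewrite !inE yx /= (stE (x, c y)); last by rewrite in_setX !inE eqxx.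
  by case: (g y); case: ((x, c y) \in t); case: ((y, c x) \in s); case: ((y, c x) \in t).
have -> : n * q = #|{: 'I_n * 'I_q}| by rewrite card_prod !card_ord.
rewrite -(card_in_imset inj) -(cardsC K) cK expnD mulnC -mulnA leq_mul2l.
rewrite -card_powerset -cardsX subset_leq_card ?orbT //.
apply/subsetP=> _ /imsetP[s sP ->]; rewrite in_setX powersetE /=.
rewrite [_ \in Ws]inE; move: sP; rewrite inE => ->; rewrite andbT.
by apply/subsetP=> z; rewrite !inE => /andP[].
Qed.

(** * Chernoff estimates in integers *)

(** Expand [(a + b) ^ #|X|] over all subsets [W]; since [b <= a], each term with [#|W| <= m] is at
    least the term for size [m]. *)
Lemma card_small_sets (X : finType) m a b : b <= a -> m <= #|X| ->
  #|[set W : {set X} | #|W| <= m]| * (a ^ (#|X| - m) * b ^ m) <= (a + b) ^ #|X|.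
Proof.
move=> ba mX.
have -> : (a + b) ^ #|X| = \sum_(W : {set X}) a ^ (#|X| - #|W|) * b ^ #|W|.
  rewrite -prod_nat_const (eq_bigr (fun _ => b + a)) => [|i _]; last exact: addnC.
  rewrite bigA_distr; apply: eq_bigr => W _.
  rewrite (bigID (mem W)) /= mulnC; congr (_ * _).
    rewrite (eq_bigr (fun _ => a)) => [|i /negPf-> //].
    by rewrite prod_nat_const -[W in RHS]setCK -cardsCs; congr (_ ^ _); apply: eq_card => i; rewrite !inE.
  rewrite (eq_bigr (fun _ => b)) => [|i -> //].
  by rewrite prod_nat_const.
rewrite [leqRHS](bigID (fun W : {set X} => #|W| <= m)) /= -sum_nat_const.
apply: leq_trans (leq_addr _ _); rewrite (eq_bigl _ _ (in_set _)).
apply: leq_sum => W Wm.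
have -> : #|X| - #|W| = (#|X| - m) + (m - #|W|) by lia.
by rewrite -[in b ^ m](subnK Wm) !expnD -!mulnA leq_mul2l leq_mul2r leq_exp2r_homo // ?orbT.
Qed.

(* Bernoulli's inequality, squared, already beats a linear factor. *)
Lemma pow_ratio_beats_linear C P Q : 0 < P -> P < Q ->
  exists M0, forall M, M0 <= M -> C * M.+1 * P ^ M <= Q ^ M.
Proof.
move=> P0 PQ.
have bern j : (P + j) * P ^ j <= P * P.+1 ^ j.
  elim: j => [|j IH]; first by rewrite addn0 !expn0.
  rewrite !expnS; nia.
pose j := 3 * C * P ^ 2.
exists (j + j) => M /subnK <-; elim: (M - _) => [|i IH].
  rewrite add0n.
  apply: (@leq_trans (P.+1 ^ (j + j))); last by rewrite leq_exp2r_homo.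
  have := leq_mul (bern j) (bern j); rewrite !expnD.
  have : C * (j + j).+1 * (P * P) <= (P + j) * (P + j) by rewrite /j; nia.
  nia.
rewrite addSn !expnS.
(* Raising the exponent [M] by one needs [P * M.+2 <= P.+1 * M.+1], that is [P <= M.+1]. *)
have : P <= (i + (j + j)).+1 \/ C = 0 by rewrite /j; nia.
case=> [|->]; nia.
Qed.

(* With the weights [D.+1] and [D] this is the Chernoff exponent at density
   [(D - 1) / 2D]; it reduces to [(1 + 1/z)^D < 1 + 1/D] for [z = 4D(D+1)]. *)
Lemma chernoff_base D : 0 < D ->
  (D + D.+1) ^ (2 * D) < 2 ^ (2 * D) * D.+1 ^ D.+1 * D ^ D.-1.
Proof.
move=> D0; pose z := 4 * D * D.+1.
have bern d : (z.+1) ^ d * (z - d) <= z ^ d.+1.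
  elim: d => [|d IH]; first by rewrite expn1 expn0 subn0 mul1n.
  rewrite !expnS in IH *; apply: leq_trans (leq_mul (leqnn z) IH).
  have : z.+1 * (z - d.+1) <= z * (z - d) by nia.
  nia.
have -> : (D + D.+1) ^ (2 * D) = z.+1 ^ D.
  by rewrite expnM; congr (_ ^ _); rewrite /z; nia.
have E : D * (2 ^ (2 * D) * D.+1 ^ D.+1 * D ^ D.-1) = D.+1 * z ^ D.
  have -> : z ^ D = 2 ^ (2 * D) * (D * D ^ D.-1) * D.+1 ^ D.
    by rewrite /z !expnMn (expnM 2 2) -expnS prednK.
  rewrite expnS; move: (2 ^ _) (D ^ _) (D.+1 ^ _); nia.
rewrite -(ltn_pmul2l D0) E; move: (bern D); rewrite expnS.
have : D * z < D.+1 * (z - D) by rewrite /z; nia.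
have : 0 < z ^ D by rewrite expn_gt0 /z; nia.
move: (z ^ D) (z.+1 ^ D) (z - D); nia.
Qed.

(** The weights [D.+1] and [D] bound the proportion of small sets by [(P / Q) ^ M], whose
    exponential decay absorbs the factor [8 * n]. *)
Lemma chernoff_count D : 0 < D -> exists n0, forall n, n0 <= n ->
  8 * n * #|[set W : {set 'I_n} | #|W| <= D.-1 * (n %/ (2 * D))]| <= 2 ^ n.
Proof.
move=> D0; have PQ := chernoff_base D0.
set P := (D + D.+1) ^ (2 * D) in PQ; set Q := 2 ^ _ * _ * _ in PQ.
have P0 : 0 < P by rewrite expn_gt0; lia.
have [M0 HM] := pow_ratio_beats_linear (16 * D) P0 PQ.
exists (2 * D * M0) => n nM; set M := n %/ (2 * D); set w := #|_|.
have D20 : 0 < 2 * D by lia.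
have MM : M0 <= M by rewrite leq_divRL // mulnC.
pose r := n %% (2 * D).
have nE : n = 2 * D * M + r by rewrite mulnC -divn_eq.
have rD : r < 2 * D by rewrite ltn_mod.
have nM1 : 8 * n <= 16 * D * M.+1 by nia.
have mn : D.-1 * M <= #|'I_n| by rewrite card_ord; nia.
have := card_small_sets (leqnSn D) mn; rewrite card_ord -/w addnC.
have -> : n - D.-1 * M = D.+1 * M + r by nia.
rewrite [in X in _ <= X]nE !expnD !(expnM _ _ M) -/P => le.
have wQ : w * Q ^ M <= P ^ M * 2 ^ n.
  rewrite [in 2 ^ n]nE expnD !(expnM _ _ M) /Q !expnMn.
  (* The remainder [r] of [n] modulo [2 * D] costs nothing, as [2 * D + 1 <= 2 * D.+1]. *)
  have rle : (D + D.+1) ^ r <= (2 ^ r * D.+1 ^ r).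
    by rewrite -expnMn leq_exp2r_homo //; lia.
  have a0 : 0 < D.+1 ^ r by rewrite expn_gt0.
  rewrite -(leq_pmul2r a0).
  move: le rle a0; set x1 := (D.+1 ^ D.+1) ^ M; set x2 := (D ^ D.-1) ^ M.
  set x3 := (2 ^ _) ^ M; set x4 := P ^ M; move: (D.+1 ^ r) (2 ^ r) ((D + D.+1) ^ r).
  have x1E : D.+1 ^ M * (D.+1 ^ D) ^ M = x1 by rewrite /x1 expnS expnMn.
  rewrite x1E => ar tr cr le rle a0.
  have := leq_mul (leqnn x3) le; have := leq_mul (leqnn (x3 * x4)) rle.
  lia.
have := HM M MM; have : 0 < P ^ M by rewrite expn_gt0 P0.
move: wQ; move: (P ^ M) (Q ^ M) (2 ^ n) => p u v wQ p0 pu.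
have /(leq_mul (leqnn w)) le2 := leq_trans (leq_mul nM1 (leqnn p)) pu.
rewrite -(leq_pmul2r p0); lia.
Qed.

(** * The random twist for large [n] *)

Lemma exists_expanding_twist n q h m (T : digraph n) (c : 'I_n -> 'I_q) :
  (forall x, ~~ T x x) -> 1 < n ->
  8 * n * #|[set W : {set 'I_n} | #|W| <= m]| <= 2 ^ n ->
  (forall A : {set 'I_n}, h <= #|A| -> 3 * n <= h * #|c @: A|) ->
  exists s, [/\ forall x, m < #|[set y | twist T c s x y]|,
                forall x, m < #|[set y | twist T c s y x]| &
                forall A B : {set 'I_n}, [disjoint A & B] -> h <= #|A| -> h <= #|B| ->
                  exists a b, [/\ a \in A, b \in B & twist T c s a b]].
Proof.
move=> T0 n1 chern spread.
pose g (p : 'I_n * bool) y := if p.2 then T p.1 y else T y p.1.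
pose F1 (p : 'I_n * bool) := [set s : {set 'I_n * 'I_q} |
  #|[set y | (y != p.1) && (g p y (+) ((p.1, c y) \in s) (+) ((y, c p.1) \in s))]| <= m].
pose F2 (p : {set 'I_n} * {set 'I_n}) :=
  [set s | [forall a in p.1, forall b in p.2, ~~ twist T c s a b]].
pose P2 (p : {set 'I_n} * {set 'I_n}) := [&& [disjoint p.1 & p.2], h <= #|p.1| & h <= #|p.2|].
pose B1 := \bigcup_(p | predT p) F1 p; pose B2 := \bigcup_(p | P2 p) F2 p.
have b1 : #|B1| * (4 * n) <= #|{: 'I_n * bool}| * 2 ^ (n * q).
  apply: card_bigcup_mul => p _.
  have := card_low_degree (g p) c p.1 m; rewrite -/(F1 p).
  have n2 : 2 ^ n = 2 * 2 ^ n.-1 by rewrite -expnS prednK //; lia.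
  have : 0 < 2 ^ n.-1 by rewrite expn_gt0.
  rewrite n2 in chern; move: chern; set w := #|_|; set f := #|_|.
  move: (2 ^ n.-1) (2 ^ (n * q)) => u v chern u0 le.
  have le1 := leq_mul (leqnn (8 * n)) le; have le2 := leq_mul (leqnn v) chern.
  rewrite -(leq_pmul2r u0); lia.
have b2 : #|B2| * 2 ^ (3 * n) <= #|{: {set 'I_n} * {set 'I_n}}| * 2 ^ (n * q).
  apply: card_bigcup_mul => p /and3P[dp hA hB].
  apply: leq_trans (card_no_arc T c dp); rewrite leq_mul2l; apply/orP; right.
  rewrite leq_exp2l //; apply: leq_trans (spread _ hA) _.
  by rewrite leq_mul2r hB orbT.
(* The [2 * n] degree events of probability at most [1 / (4 * n)] fill at most half of the space;
   the at most [2 ^ (2 * n)] pairs, each of probability at most [1 / 2 ^ (3 * n)], fill at most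
   [1 / 2 ^ n <= 1 / 4]. *)
have : B1 :|: B2 != setT.
  apply/negP=> /eqP E; have := (leq_card_setU B1 B2).1.
  have card_set (X : finType) : #|{: {set X}}| = 2 ^ #|X|.
    by rewrite -[in RHS]cardsT -card_powerset powersetT cardsT.
  move: b1 b2; rewrite E cardsT !card_prod !card_set card_prod card_bool !card_ord.
  rewrite (_ : 3 * n = n + n + n) ?expnD; last lia.
  have : 0 < 2 ^ (n * q) by rewrite expn_gt0.
  have : 4 <= 2 ^ n by rewrite (leq_exp2l 2 n (_ : 1 < 2)).
  move: (2 ^ n) (2 ^ (n * q)) #|B1| #|B2| => u v x y u4 v0 b1 b2.
  have {}b1 : 2 * x <= v.
    have n0 : 0 < 2 * n by lia.
    rewrite -(leq_pmul2r n0); lia.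
  have {}b2 : y * u <= v.
    have u0 : 0 < u * u by nia.
    rewrite -(leq_pmul2r u0); lia.
  nia.
rewrite -subTset => /subsetPn[s _]; rewrite inE negb_or => /andP[s1 s2].
exists s; have deg p : s \notin F1 p.
  by apply: contra s1 => sp; apply/bigcupP; exists p.
split=> [x|x|A B dAB hA hB].
- have := deg (x, true); rewrite inE -ltnNge => /leq_trans; apply.
  apply: subset_leq_card; apply/subsetP=> y; rewrite !inE => /andP[_].
  by rewrite /g /twist.
- have := deg (x, false); rewrite inE -ltnNge => /leq_trans; apply.
  apply: subset_leq_card; apply/subsetP=> y; rewrite !inE => /andP[_].
  by rewrite /g /twist -!addbA [(_ \in s) (+) _]addbC.
have : s \notin F2 (A, B).
  by apply: contra s2 => sp; apply/bigcupP; exists (A, B) => //; rewrite /P2 dAB hA.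
rewrite inE negb_forall_in => /exists_inP[a aA].
rewrite negb_forall_in => /exists_inP[b bB]; rewrite negbK => ab.
by exists a, b.
Qed.

Lemma card_spread n q (c : 'I_n -> 'I_q) (A : {set 'I_n}) :
  (forall y, c y = y %% q :> nat) -> #|A| <= #|c @: A| * (n %/ q).+1.
Proof.
move=> cE; rewrite -sum_nat_const -sum1_card (partition_big_imset c) /=.
apply: leq_sum => j _; rewrite sum1_card; apply: leq_trans (card_class j cE).
by apply: subset_leq_card; apply/subsetP=> y; rewrite !inE => /andP[].
Qed.

Lemma sinv_large E : 0 < E -> exists n0 q, forall n k (T : digraph n),
  is_tournament T -> n0 <= n -> (2 * E).+1 * k <= E * n ->
  exists m, sinv k T = Some m /\ m <= q.
Proof.
(* As [2 * D = 4 * (2 * E).+1], the hypothesis gives [k <= 4 * E * M.+1], while Chernoff yields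
   degrees above [D.-1 * M = (4 * E + 1) * M]; the surplus is [h = M - 4 * E]. A set of
   [h >= n / (8 * D)] vertices meets at least [q / (16 * D) = 24 * D] classes, and
   [h * (24 * D) >= 3 * n]. *)
move=> E0; pose D := 4 * E + 2; pose q := 384 * D * D.
have D0 : 0 < D by rewrite /D; lia.
have [n1 chern] := chernoff_count D0.
exists (n1 + q + 16 * D * E), (3 * q) => n k T tT nn kn.
have q0 : 0 < q by rewrite /q; nia.
pose M := n %/ (2 * D); pose h := M - 4 * E.
have D20 : 0 < 2 * D by lia.
have ME : 8 * E <= M by rewrite leq_divRL //; lia.
have nM : n < 2 * D * M.+1 by rewrite mulnC -ltn_divLR.
have nh : n <= 8 * D * h.
  have M4 : M.+1 <= 4 * h by rewrite /h; lia.
  have := leq_mul (leqnn (2 * D)) M4; lia.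
have kM : k <= 4 * E * M.+1.
  rewrite -(leq_pmul2l (ltn0Sn (2 * E))); apply: leq_trans kn _.
  have := leq_mul (leqnn E) (ltnW nM); rewrite /D; lia.
pose c (y : 'I_n) : 'I_q := Ordinal (ltn_pmod y q0).
have spread (A : {set 'I_n}) : h <= #|A| -> 3 * n <= h * #|c @: A|.
  move=> hA; have := card_spread A (fun y => erefl : c y = y %% q :> nat).
  set r := #|c @: A| => le.
  have nq := leq_trunc_div n q.
  have qn : (n %/ q).+1 * q <= 2 * n by lia.
  have le2 : h * q <= r * (2 * n).
    have := leq_mul (leq_trans hA le) (leqnn q); have := leq_mul (leqnn r) qn; lia.
  have le3 : q <= 16 * D * r.
    rewrite -(@leq_pmul2l n); last lia.
    have := leq_mul nh (leqnn q); have := leq_mul (leqnn (8 * D)) le2; lia.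
  have Dr : 24 * D <= r.
    rewrite -(@leq_pmul2l (16 * D)); last lia.
    by apply: leq_trans le3; rewrite /q; lia.
  have := leq_mul (leqnn h) Dr; lia.
have nbig : 1 < n by have : 0 < D * D; rewrite ?muln_gt0 ?D0 // /q in nn *; lia.
have [s [dout din exp]] := exists_expanding_twist tT.1 nbig (chern n ltac:(lia)) spread.
have kh : k + h <= D.-1 * M by rewrite /h (_ : D.-1 = (4 * E).+1) /D; lia.
rewrite -(size_twist_sets c s); apply: sinv_le.
rewrite (eq_kstrong k (invert_seq_twist c s tT)).
apply: (@kstrong_expanding n k h) => // [|x|x].
- by rewrite ltnNge; apply/negP=> /(leq_mul (leqnn E)); lia.
- exact: leq_trans kh (ltnW (dout x)).
- exact: leq_trans kh (ltnW (din x)).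
Qed.

(** * Bounded [n]: powers of a Hamiltonian cycle *)

(** Deleting fewer than [k] vertices spares one of the [k] cyclic successors of any vertex. A walk
    thus advances until its target is within distance [k], then jumps there directly. *)
Lemma kstrong_circulant n k (D : digraph n) :
  k < n -> (forall x y : 'I_n, 0 < (y + n - x) %% n <= k -> D x y) -> kstrong k D.
Proof.
move=> kn Dk; rewrite /kstrong kn; apply/forallP=> S; apply/implyP=> Sk.
apply/forallP=> x; apply/forallP=> y; apply/implyP=> xS; apply/implyP=> yS.
set e := (X in connect X).
have n0 : 0 < n by lia.
pose sh (z : 'I_n) d : 'I_n := Ordinal (ltn_pmod (z + d) n0).
have shD z d : 0 < d < n -> (sh z d + n - z) %% n = d.
  move=> /andP[d0 dn]; have zn := ltn_ord z; rewrite /=.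
  have [lt|ge] := ltnP (z + d) n.
    by rewrite (modn_small lt) (_ : _ - z = d + n) ?modnDr ?modn_small //; lia.
  rewrite -{1}(subnK ge) modnDr (@modn_small (z + d - n)); last lia.
  by rewrite (_ : _ - z = d) ?modn_small //; lia.
have next z : exists i : 'I_k, sh z i.+1 \notin S.
  apply/existsP; apply: contraLR Sk => /existsPn sS; rewrite -leqNgt.
  have inj : injective (fun i : 'I_k => sh z i.+1).
    move=> i j /(congr1 val) /= /eqP; rewrite eqn_modDl !modn_small => [/eqP[/val_inj]//||].
      by have := ltn_ord j; lia.
    by have := ltn_ord i; lia.
  rewrite -[X in X <= _]card_ord -(card_imset predT inj).
  apply: subset_leq_card; apply/subsetP=> _ /imsetP[i _ ->].
  by have := sS i; rewrite negbK.
have step z d : z \notin S -> sh z d \notin S -> 0 < d <= k -> connect e z (sh z d).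
  move=> zS zdS /andP[d0 dk]; apply: connect1; rewrite /e /= zS zdS; apply: Dk.
  by rewrite shD d0 //; lia.
have reach d : forall z, z \notin S -> sh z d \notin S -> connect e z (sh z d).
  have [m] := ubnP d; elim: m d => [//|m IH] d /ltnSE dm z zS zdS.
  case: d => [|d] in dm zdS *.
    suff -> : sh z 0 = z by [].
    by apply/val_inj; rewrite /= addn0 modn_small.
  have [dk|kd] := leqP d.+1 k; first exact: step.
  have [i ziS] := next z; have ik := ltn_ord i.
  apply: connect_trans (step _ _ zS ziS _) _; first lia.
  have E : sh z d.+1 = sh (sh z i.+1) (d - i).
    by apply/val_inj; rewrite /= modnDml; congr (_ %% _); lia.
  by rewrite E in zdS *; apply: IH => //; lia.
have yE : sh x ((y + n - x) %% n) = y.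
  apply/val_inj => /=; rewrite modnDmr addnC subnK ?modnDr ?modn_small //.
  by have := ltn_ord x; lia.
by have := reach ((y + n - x) %% n) x xS; rewrite yE; apply.
Qed.

Lemma sinv_small n k (T : digraph n) : is_tournament T -> 2 * k < n ->
  exists m, sinv k T = Some m /\ m <= 3 * n.
Proof.
move=> tT kn; pose g (x y : 'I_n) := 0 < (y + n - x) %% n <= k.
(* With [c = id] each pair has its own two bits; the one at its smaller vertex decides the flip. *)
pose s := [set p : 'I_n * 'I_n | (p.1 < p.2) && (T p.1 p.2 != g p.1 p.2)].
rewrite -(size_twist_sets id s); apply: sinv_le.
rewrite (eq_kstrong k (invert_seq_twist id s tT)).
apply: kstrong_circulant => [|x y gxy]; first lia.
have xn := ltn_ord x; have yn := ltn_ord y.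
rewrite /twist !inE /=; case: (ltngtP x y) => [xy|yx|/val_inj xy] /=.
- have -> : g x y = true by [].
  by case: (T x y).
(* The two cyclic distances of a pair sum to [n > 2 * k], so [g] never prescribes both
   directions. *)
- have -> : g y x = false.
    move: gxy; rewrite /g modn_small; last lia.
    by rewrite (_ : x + n - y = x - y + n) ?modnDr ?modn_small; lia.
  have := tT.2 x y; rewrite -val_eqE /= gtn_eqF // => /(_ isT).
  by case: (T x y); case: (T y x).
- by move: gxy; rewrite xy addnC addnK modnn.
Qed.

(** * Combining both ranges of [n] *)

(** This is the case [eps = 1 / E], multiplied by [E]. The summand [E] forces [2 * k < n], as small
    [n] requires. *)
Lemma sinv_bounded (E : nat) : 0 < E -> exists b, forall n k (T : digraph n),
  is_tournament T -> (2 * E).+1 * k + E <= E * n ->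
  exists m, sinv k T = Some m /\ m <= b.
Proof.
move=> E0; have [n0 [q big]] := sinv_large E0; exists (q + 3 * n0) => n k T tT kn.
have [nn|nn] := leqP n0 n.
  have [|m [-> mq]] := big n k T tT nn; first lia.
  by exists m; split=> //; lia.
have [|m [-> mn]] := @sinv_small n k T tT; last by exists m; split=> //; lia.
rewrite -(ltn_pmul2l E0); lia.
Qed.

Theorem theorem1p15 :
  exists f : R -> nat,
    forall (eps : R), Rlt 0 eps ->
    forall (k : nat), (0 < k)%N ->
    forall (n : nat) (T : digraph n), is_tournament T ->
      Rle (Rplus (Rplus (Rmult 2 (INR k)) 1) (Rmult eps (INR k))) (INR n) ->
      exists m, sinv k T = Some m /\ (m <= f eps)%N.
Proof.
suff bound eps : exists b, Rlt 0 eps -> forall k n (T : digraph n), is_tournament T ->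
    Rle (Rplus (Rplus (Rmult 2 (INR k)) 1) (Rmult eps (INR k))) (INR n) ->
    exists m, sinv k T = Some m /\ m <= b.
  exists (fun eps => proj1_sig (constructive_indefinite_description _ (bound eps))).
  move=> eps eps0 k _ n T.
  by case: constructive_indefinite_description => b /= /(_ eps0 k n T).
(* Choice needs a bound at every real; the value at nonpositive [eps] is arbitrary. *)
have [eps0|] := Rlt_dec 0 eps; last by exists 0.
have [E [invE E0]] := archimed_cor1 eps eps0.
have [|b bE] := @sinv_bounded E; first exact/ltP.
exists b => _ k n T tT len; apply: bE => //; apply/leP/INR_le.
rewrite plus_INR !mult_INR S_INR mult_INR /=.
have iE : Rlt 0 (INR E) by exact: lt_0_INR.
have k0 := pos_INR k.
have Ee : Rle 1 (Rmult (INR E) eps).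
  apply: (Rmult_le_reg_l (/ INR E)); first exact: Rinv_0_lt_compat.
  by rewrite -Rmult_assoc Rinv_l; lra.
have := Rmult_le_compat_l _ _ _ (Rlt_le _ _ iE) len.
have := Rmult_le_compat_r _ _ _ k0 Ee.
lra.
Qed.
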